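(* Let $\mathcal C_n$ be a weighted cycle with strictly positive edge conductances and Laplacian $L$, let $0\le p<q\le n-1$, let $w\ge 0$, and let $L_{p,q}(w)=L+w\boldsymbol b\boldsymbol b^\top$ with $\boldsymbol b=\boldsymbol e_p-\boldsymbol e_q$. Then: (i) $$R_{pq}(w)=\frac{R_{pq}}{1+wR_{pq}}=\frac{A_{pq}B_{pq}}{T+wA_{pq}B_{pq}}.$$ (ii) For any unordered pair $\{u,v\}$ of vertices, $$R_{uv}(w)=R_{uv}-\frac{w}{4(1+wR_{pq})}\bigl(R_{uq}+R_{vp}-R_{up}-R_{vq}\bigr)^2.$$ (iii) $$K_f(L)=\frac1T\sum_{0\le u<v\le n-1}d(u,v)\bigl(T-d(u,v)\bigr),$$ and $$K_f(L_{p,q}(w))=K_f(L)-\mathcal I_{p,q}(w),$$ where $$\mathcal I_{p,q}(w):=\frac{w\sum_{0\le u<v\le n-1}\bigl(R_{uq}+R_{vp}-R_{up}-R_{vq}\bigr)^2}{4(1+wR_{pq})}.$$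
   Context: The weighted cycle $\mathcal C_n$ ($n\ge 3$) has vertices $v_0,\dots,v_{n-1}$ and edges $\{v_i,v_{i+1}\}$ (indices mod $n$) with conductances (weights) $c_{i,i+1}>0$. Its Laplacian is $L=D-A$, where $A$ is the weighted adjacency matrix and $D$ the diagonal matrix of weighted degrees. $\boldsymbol e_i$ is the $i$th canonical basis vector of $\mathbb R^n$. Put $r_s:=1/c_{s,s+1}$ and $T:=\sum_{s=0}^{n-1}r_s$. For $a,b\in\{0,\dots,n-1\}$ the directed arc resistance is $d(a,b):=\sum_{s=a}^{b-1}r_s$ if $a<b$, $d(a,a):=0$, and $d(a,b):=\sum_{s=a}^{n-1}r_s+\sum_{s=0}^{b-1}r_s$ if $a>b$. For $p<q$, $A_{pq}:=d(p,q)$ and $B_{pq}:=d(q,p)$, so $A_{pq}+B_{pq}=T$. For a connected weighted graph with Laplacian $M$ on these $n$ vertices, the effective resistance between $v_i$ and $v_j$ is $(\boldsymbol e_i-\boldsymbol e_j)^\top M^\dagger(\boldsymbol e_i-\boldsymbol e_j)$, where $M^\dagger$ is the Moore–Penrose pseudoinverse, and the Kirchhoff index $K_f(M)$ is the sum of the effective resistances over all pairs $0\le i<j\le n-1$. $R_{ij}$ denotes the effective resistance for $L$, and $R_{ij}(w)$ the effective resistance for $L_{p,q}(w)$. *)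

(* Defs.v *)
From HB Require Import structures.
From mathcomp Require Import all_boot all_order all_algebra reals.
Set Implicit Arguments.
Unset Strict Implicit.
Unset Printing Implicit Defensive.
Import Order.TTheory GRing.Theory Num.Theory.
Local Open Scope ring_scope.

Section MoorePenrose.
Variable R : realFieldType.

Definition is_mp_pinv m n (M : 'M[R]_(m, n)) (X : 'M[R]_(n, m)) : Prop :=
  [/\ M *m X *m M = M,
      X *m M *m X = X,
      (M *m X)^T = M *m X
    & (X *m M)^T = X *m M].

(* With the rank factorization M = C *m F (C of full column rank, F of full
   row rank), M^+ = F^T (F F^T)^-1 (C^T C)^-1 C^T.  This is characterized by
   [mp_pinvP] and [mp_pinv_uniq] below.  MathComp's [pinvmx] is only some
   partial inverse, not the Moore-Penrose one. *)
Definition mp_pinv m n (M : 'M[R]_(m, n)) : 'M[R]_(n, m) :=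
  let C := col_base M in
  let F := row_base M in
  F^T *m invmx (F *m F^T) *m invmx (C^T *m C) *m C^T.

Lemma row_free_gram_unit m n (F : 'M[R]_(m, n)) :
  row_free F -> F *m F^T \in unitmx.
Proof.
move=> Ffree; rewrite -row_free_unit; apply/inj_row_free => v vFF0.
have vF0 : v *m F = 0.
  have: ((v *m F) *m (v *m F)^T) 0 0 = 0.
    by rewrite trmx_mul mulmxA -(mulmxA v) vFF0 mul0mx mxE.
  move: (v *m F) => u; rewrite mxE => uu0.
  have /psumr_eq0P sq0 : \sum_j u 0 j ^+ 2 = 0.
    by rewrite -[RHS]uu0; apply: eq_bigr => j _; rewrite mxE expr2.
  apply/rowP => j; rewrite [RHS]mxE; apply/eqP.
  by rewrite -sqrf_eq0 sq0 // => i _; exact: sqr_ge0.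
by apply: (row_free_inj Ffree); rewrite /= vF0 mul0mx.
Qed.

Lemma mp_pinvP m n (M : 'M[R]_(m, n)) : is_mp_pinv M (mp_pinv M).
Proof.
rewrite /is_mp_pinv /mp_pinv; have := mulmx_base M.
have := col_base_full M; have := row_base_free M.
move: (\rank M) (col_base M) (row_base M) => r C F Ffree Cfull <-.
have GF := row_free_gram_unit Ffree.
have GC : C^T *m C \in unitmx.
  rewrite -{2}[C]trmxK; apply: row_free_gram_unit.
  by rewrite /row_free mxrank_tr.
set X := F^T *m _ *m _ *m _.
have MX : C *m F *m X = C *m invmx (C^T *m C) *m C^T.
  by rewrite /X !mulmxA -(mulmxA C F) -(mulmxA C _ (invmx (F *m F^T))) mulmxV // mulmx1.
have XM : X *m (C *m F) = F^T *m invmx (F *m F^T) *m F.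
  by rewrite /X -!mulmxA (mulmxA C^T C) (mulmxA (invmx (C^T *m C))) mulVmx // mul1mx.
split.
- by rewrite MX -!mulmxA (mulmxA C^T C) (mulmxA (invmx (C^T *m C))) mulVmx // mul1mx.
- by rewrite XM /X !mulmxA -(mulmxA _ F) -(mulmxA _ (F *m F^T)) mulmxV // mulmx1.
- by rewrite MX !trmx_mul trmx_inv trmx_mul !trmxK mulmxA.
- by rewrite XM !trmx_mul trmx_inv trmx_mul !trmxK mulmxA.
Qed.

Lemma mp_pinv_uniq m n (M : 'M[R]_(m, n)) (X Y : 'M[R]_(n, m)) :
  is_mp_pinv M X -> is_mp_pinv M Y -> X = Y.
Proof.
move=> [mx1 mx2 mx3 mx4] [my1 my2 my3 my4].
have eMX : M *m X = M *m Y.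
  by rewrite -mx3 -{1}my1 -mulmxA trmx_mul mx3 my3 !mulmxA mx1.
have eXM : X *m M = Y *m M.
  by rewrite -mx4 -{1}my1 mulmxA mulmxA -(mulmxA (X *m M)) trmx_mul mx4 my4
    -!mulmxA (mulmxA M X M) mx1.
by rewrite -mx2 eXM -mulmxA eMX mulmxA my2.
Qed.

End MoorePenrose.

Section WeightedGraph.
Variables (R : realFieldType) (n : nat).

Definition degree_mx (A : 'M[R]_n) : 'M[R]_n :=
  diag_mx (\row_i \sum_j A i j).

Definition laplacian (A : 'M[R]_n) : 'M[R]_n := degree_mx A - A.

Definition ediff (i j : 'I_n) : 'cV[R]_n := delta_mx i 0 - delta_mx j 0.

Definition effres (M : 'M[R]_n) (i j : 'I_n) : R :=
  ((ediff i j)^T *m mp_pinv M *m ediff i j) 0 0.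

Definition kirchhoff (M : 'M[R]_n) : R :=
  \sum_(i < n) \sum_(j < n | (i < j)%N) effres M i j.

End WeightedGraph.

Section WeightedCycle.
Variables (R : realFieldType) (n : nat).

(* [c i] is the conductance of the edge {v_i, v_(i+1 mod n)}; [ordS i] is
   i + 1 mod n.  For n >= 3 the two conditions below are exclusive. *)
Variable c : 'I_n -> R.

Definition cycle_adj : 'M[R]_n :=
  \matrix_(i, j) (if j == ordS i then c i
                  else if i == ordS j then c j else 0).

Definition cycle_laplacian : 'M[R]_n := laplacian cycle_adj.

Definition chord_laplacian (p q : 'I_n) (w : R) : 'M[R]_n :=
  cycle_laplacian + w *: (ediff R p q *m (ediff R p q)^T).

Definition edge_res (s : 'I_n) : R := 1 / c s.

Definition total_res : R := \sum_(s < n) edge_res s.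

Definition arc_res (a b : 'I_n) : R :=
  if (a < b)%N then \sum_(s < n | (a <= s < b)%N) edge_res s
  else if a == b then 0
  else \sum_(s < n | (a <= s)%N) edge_res s
       + \sum_(s < n | (s < b)%N) edge_res s.

Definition kirchhoff_drop (p q : 'I_n) (w : R) : R :=
  let Rs := effres cycle_laplacian in
  (w * \sum_(u < n) \sum_(v < n | (u < v)%N)
         (Rs u q + Rs v p - Rs u p - Rs v q) ^+ 2)
  / (4 * (1 + w * Rs p q)).

End WeightedCycle.

(* Main.v *)
Require Import Defs.
From HB Require Import structures.
From mathcomp Require Import all_boot all_order all_algebra reals.
From mathcomp Require Import ring lra zify.
Set Implicit Arguments.
Unset Strict Implicit.
Unset Printing Implicit Defensive.
Import Order.TTheory GRing.Theory Num.Theory.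
Local Open Scope ring_scope.

(** The effective resistance of a symmetric matrix M is the drop of a
    potential: if M x = e_i - e_j, then M M^+ M = M gives
      (e_i - e_j)^T M^+ (e_i - e_j) = x^T M M^+ M x = x^T M x = x_i - x_j
    ([effres_potential]).  So every claim about M^+ becomes a claim about
    explicit solutions of M x = e_i - e_j, and the kernel of M never has to
    be discussed.

    For a rank-one update, write b = e_p - e_q, M x = e_u - e_v, M y = b.
    Since b^T x is the drop x_p - x_q, subtracting a suitable multiple of y
    from x solves the same equation for M + w b b^T; the multiple is the one
    of the Sherman-Morrison formula, and reading off the drop between u and v
    gives
      R_uv(w) = R_uv - w (x_p - x_q)^2 / (1 + w R_pq)
    ([effres_add_edge_potential]).  The transfer term x_p - x_q equals
    (e_u - e_v)^T M^+ (e_p - e_q), which polarizes into half of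
    R_uq + R_vp - R_up - R_vq ([effres_polarization]).  This is (ii), and (i)
    is the case {u,v} = {p,q}.

    On the cycle the solution of L x = e_a - e_b is given by the current
    divider: for a < b a unit current splits between the two arcs in inverse
    proportion to their resistances, so the edges s with a <= s < b carry
    1 - d(a,b)/T and the others carry -d(a,b)/T.  Ohm's law integrates this
    current into a potential, consistently around the cycle because the total
    drop vanishes ([arc_flow_kvl]).  The drop along the arc from a to b is
    R_ab = d(a,b) (T - d(a,b)) / T ([effres_cycle]); summing over all pairs
    gives (iii). *)

(** * Effective resistances as potential drops *)

Section Potentials.
Variables (R : realFieldType) (n : nat).
Implicit Types (M : 'M[R]_n) (x y : 'cV[R]_n).

(** On the range of a symmetric matrix the quadratic form of the
    pseudoinverse can be evaluated with any preimages, because M M^+ M = M. *)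
Lemma mp_pinv_range_form M x y :
  M^T = M -> (M *m x)^T *m mp_pinv M *m (M *m y) = x^T *m (M *m y).
Proof.
move=> symM; have [MXM _ _ _] := mp_pinvP M.
by rewrite trmx_mul symM -[in RHS]MXM !mulmxA.
Qed.

Lemma mul_ediff m (A : 'M[R]_(m, n)) (i j : 'I_n) k :
  (A *m ediff R i j) k 0 = A k i - A k j.
Proof. by rewrite mulmxBr -!colE !mxE. Qed.

Lemma ediff_mul m (i j : 'I_n) (A : 'M[R]_(n, m)) k :
  ((ediff R i j)^T *m A) 0 k = A i k - A j k.
Proof. by rewrite -[_ *m A]trmxK trmx_mul trmxK mxE mul_ediff !mxE. Qed.

Lemma ediffE (i j k : 'I_n) :
  ediff R i j k 0 = (k == i)%:R - (k == j)%:R.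
Proof. by rewrite !mxE !andbT. Qed.

Lemma effresE M i j :
  effres M i j = mp_pinv M i i + mp_pinv M j j - mp_pinv M i j - mp_pinv M j i.
Proof. by rewrite /effres mul_ediff !ediff_mul; ring. Qed.

Lemma effres_potential M x i j :
  M^T = M -> M *m x = ediff R i j -> effres M i j = x i 0 - x j 0.
Proof.
move=> symM Mx.
by rewrite /effres -{1 2}Mx mp_pinv_range_form // Mx mul_ediff !mxE.
Qed.

(** With b_ij = e_i - e_j, the combination of resistances expands to
    b_uv^T M^+ b_pq + b_pq^T M^+ b_uv, and each of these two terms is the drop
    between p and q of the potential x. *)
Lemma effres_polarization M x y u v p q :
    M^T = M -> M *m x = ediff R u v -> M *m y = ediff R p q ->
  effres M u q + effres M v p - effres M u p - effres M v q
    = 2 * (x p 0 - x q 0).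
Proof.
move=> symM Mx My.
have xpq : ((ediff R u v)^T *m mp_pinv M *m ediff R p q) 0 0 = x p 0 - x q 0.
  by rewrite -Mx -My mp_pinv_range_form // My mul_ediff !mxE.
have ypq : ((ediff R p q)^T *m mp_pinv M *m ediff R u v) 0 0 = x p 0 - x q 0.
  rewrite -Mx -My mp_pinv_range_form // mulmxA -{1}symM -trmx_mul My.
  by rewrite ediff_mul.
rewrite mulr2n mulrDl mul1r -{1}xpq -ypq !effresE !mul_ediff !ediff_mul.
ring.
Qed.

(** The Sherman-Morrison formula at the level of potentials: as
    b b^T z = (z_p - z_q) b, the matrix M + w b b^T sends x - t y to
    e_u - e_v when t (1 + w R_pq) = w (x_p - x_q).  No inverse of M is used,
    so the singularity of a Laplacian is harmless. *)
Lemma effres_add_edge_potential M x y u v p q w :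
    M^T = M -> M *m x = ediff R u v -> M *m y = ediff R p q ->
    1 + w * effres M p q != 0 ->
  effres (M + w *: (ediff R p q *m (ediff R p q)^T)) u v
    = effres M u v - w / (1 + w * effres M p q) * (x p 0 - x q 0) ^+ 2.
Proof.
move=> symM Mx My nz; set b := ediff R p q.
set D := 1 + _ in nz *; set g := x p 0 - x q 0.
have bz z : b *m (b^T *m z) = (z p 0 - z q 0) *: b.
  by rewrite [b^T *m z]mx11_scalar ediff_mul mul_mx_scalar.
(* Reciprocity: y_u - y_v = y^T M x = x_p - x_q, by the symmetry of M. *)
have yuv : y u 0 - y v 0 = g.
  rewrite -(ediff_mul u v y) -Mx trmx_mul symM -mulmxA My.
  by rewrite mul_ediff !mxE.
have symMw : (M + w *: (b *m b^T))^T = M + w *: (b *m b^T).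
  by rewrite linearD linearZ /= trmx_mul trmxK symM.
have Mwx : (M + w *: (b *m b^T)) *m (x - (w * g / D) *: y) = ediff R u v.
  rewrite mulmxDl -scalemxAl -mulmxA bz !mxE mulmxBr -scalemxAr Mx My scalerA.
  rewrite -addrA -scaleNr -scalerDl.
  have -> : - (w * g / D) +
     w * (x p 0 - w * g / D * y p 0 - (x q 0 - w * g / D * y q 0)) = 0.
    have DE : D = 1 + w * (y p 0 - y q 0).
      by rewrite /D (effres_potential symM My).
    rewrite /g; move: nz; rewrite DE => nz.
    by field.
  by rewrite scale0r addr0.
rewrite (effres_potential symMw Mwx) (effres_potential symM Mx) !mxE.
have -> : x u 0 - w * g / D * y u 0 - (x v 0 - w * g / D * y v 0)
   = x u 0 - x v 0 - w * g / D * (y u 0 - y v 0) by ring.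
by rewrite yuv expr2; congr (_ - _); ring.
Qed.

Lemma laplacian_mul (A : 'M[R]_n) x i :
  (laplacian A *m x) i 0 = \sum_j A i j * (x i 0 - x j 0).
Proof.
rewrite mulmxBl mul_diag_mx !mxE mulr_suml -sumrB.
by apply: eq_bigr => j _; rewrite mulrBr.
Qed.

Lemma trmx_laplacian (A : 'M[R]_n) : A^T = A -> (laplacian A)^T = laplacian A.
Proof. by move=> symA; rewrite linearB /= tr_diag_mx symA. Qed.

End Potentials.

(** * Currents and potentials around the cycle *)

Section Arcs.
Variables (R : realFieldType) (n : nat) (c : 'I_n -> R).

Local Notation r := (edge_res c).
Local Notation T := (total_res c).
Local Notation d := (arc_res c).

Lemma sum_ltS (F : 'I_n -> R) (i : 'I_n) :
  \sum_(s < n | (s < i.+1)%N) F s = \sum_(s < n | (s < i)%N) F s + F i.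
Proof.
rewrite (bigD1 i) //= addrC; congr (_ + _); apply: eq_bigl => s.
by rewrite ltnS ltn_neqAle andbC.
Qed.

Definition flow_potential (f : 'I_n -> R) : 'cV[R]_n :=
  \col_i - \sum_(s < n | (s < i)%N) r s * f s.

(** Ohm's law across every edge.  On the closing edge from n - 1 to 0 it holds
    because the total drop around the cycle is zero. *)
Lemma flow_potential_step f i :
    \sum_s r s * f s = 0 ->
  flow_potential f i 0 - flow_potential f (ordS i) 0 = r i * f i.
Proof.
move=> kvl; rewrite !mxE opprK.
(* At the closing edge the sum over s < n is zero, and so is the empty sum. *)
suff -> : \sum_(s < n | (s < ordS i)%N) r s * f s
        = \sum_(s < n | (s < i.+1)%N) r s * f s by rewrite sum_ltS; ring.
rewrite /=; have [lt_iS|] := ltnP i.+1 n; first by rewrite modn_small.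
move=> le_n; have -> : i.+1 = n by have := ltn_ord i; lia.
rewrite modnn big_pred0 //; rewrite -[LHS]kvl.
by apply: eq_bigl => s; rewrite ltn_ord.
Qed.

Lemma arc_resE (a b : 'I_n) :
  (a < b)%N -> d a b = \sum_(s < n | (a <= s < b)%N) r s.
Proof. by rewrite /arc_res => ->. Qed.

Lemma arc_res_flip (a b : 'I_n) : (a < b)%N -> d b a = T - d a b.
Proof.
move=> ab; rewrite (arc_resE ab) /arc_res ltnNge (ltnW ab) /=.
have -> : (b == a) = false by apply/eqP => e; rewrite e ltnn in ab.
apply/(canRL (addrK _)); rewrite /total_res.
rewrite [RHS](bigID (fun s : 'I_n => (b <= s)%N)) /= -addrA; congr (_ + _).
rewrite [RHS](bigID (fun s : 'I_n => (s < a)%N)) /=; congr (_ + _).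
  by apply: eq_bigl => s; lia.
by apply: eq_bigl => s; lia.
Qed.

(** The current divider: the edge currents produced by a unit current that
    enters at a and leaves at b, when a < b. *)
Definition arc_flow (a b s : 'I_n) : R := (a <= s < b)%N%:R - d a b / T.

Lemma sum_arc_indicator (a b : 'I_n) (P : pred 'I_n) :
  (a < b)%N -> (forall s : 'I_n, (a <= s < b)%N -> P s) ->
  \sum_(s | P s) r s * (a <= s < b)%N%:R = d a b.
Proof.
move=> ab sub; rewrite arc_resE // (big_mkcond P).
rewrite [RHS]big_mkcond; apply: eq_bigr => s _.
case: ifP => [_|]; last by case: ifP => // /sub ->.
by case: ifP; rewrite ?mulr1 ?mulr0.
Qed.

(** Kirchhoff's current law for the unit current carried by the edges s with
    a <= s < b: edge i leaves vertex i and edge i - 1 (mod n) enters it.  The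
    identity is additive in nat so as to avoid truncated subtraction. *)
Lemma arc_boundary (a b i : 'I_n) : (a < b)%N ->
  ((a <= i < b) + (i == b) = (a <= ord_pred i < b) + (i == a))%N.
Proof.
move=> ab; have := ltn_ord b; have := ltn_ord i.
have -> : ord_pred i = (if i == 0 :> nat then n.-1 else i.-1) :> nat.
  rewrite /=; have := ltn_ord i => lti; case: eqP => [->|i0].
    by rewrite add0n modn_small; lia.
  have -> : ((i + n).-1 = i.-1 + n)%N by lia.
  by rewrite modnDr modn_small; lia.
by rewrite -!(inj_eq val_inj) /=; case: (nat_of_ord i =P 0); lia.
Qed.

End Arcs.

(** * Effective resistances of the cycle *)

Section Cycle.
Variables (R : realFieldType) (n : nat) (c : 'I_n -> R).
Hypotheses (n_ge3 : (3 <= n)%N) (c_gt0 : forall i, 0 < c i).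

Local Notation L := (cycle_laplacian c).
Local Notation r := (edge_res c).
Local Notation T := (total_res c).
Local Notation d := (arc_res c).

Lemma edge_res_gt0 s : 0 < r s.
Proof. by rewrite divr_gt0. Qed.

Lemma arc_res_ge0 (a b : 'I_n) : 0 <= d a b.
Proof.
have sum_ge0 (P : pred 'I_n) : 0 <= \sum_(s | P s) r s.
  by apply: sumr_ge0 => s _; rewrite ltW ?edge_res_gt0.
by rewrite /arc_res; do 2?case: ifP => // _; rewrite ?addr_ge0.
Qed.

Lemma total_res_gt0 : 0 < T.
Proof.
have n_gt0 : (0 < n)%N by lia.
rewrite /total_res (bigD1 (Ordinal n_gt0)) //= ltr_pwDl ?edge_res_gt0 //.
by apply: sumr_ge0 => s _; rewrite ltW ?edge_res_gt0.
Qed.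

(** The unit current on the arc from a to b drops d(a,b), and so does the
    uniform current d(a,b)/T around the whole cycle. *)
Lemma arc_flow_kvl (a b : 'I_n) :
  (a < b)%N -> \sum_s r s * arc_flow c a b s = 0.
Proof.
move=> ab; under eq_bigr do rewrite mulrBr.
rewrite sumrB sum_arc_indicator // -mulr_suml -/(total_res c).
by rewrite mulrC divfK ?subrr // gt_eqF ?total_res_gt0.
Qed.

(** This is where n >= 3 matters: on two vertices both edges would compete for
    the same entry of the adjacency matrix. *)
Lemma ordS_asym (i j : 'I_n) : j = ordS i -> i != ordS j.
Proof.
move=> ->; apply/eqP => /(congr1 val) /=.
rewrite -addn1 modnDml addn1.
have [lt1|ge1] := ltnP i.+2 n; first by rewrite modn_small; lia.
have := ltn_ord i; move=> lti.
have -> : i.+2 = (i.+2 - n + n)%N by lia.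
by rewrite modnDr modn_small; lia.
Qed.

Lemma trmx_cycle_laplacian : L^T = L.
Proof.
apply: trmx_laplacian; apply/matrixP => i j; rewrite !mxE.
by have [/ordS_asym/negPf ->|] := eqVneq j (ordS i).
Qed.

Lemma cycle_laplacian_mul (x : 'cV[R]_n) i :
  (L *m x) i 0 = c i * (x i 0 - x (ordS i) 0)
    - c (ord_pred i) * (x (ord_pred i) 0 - x i 0).
Proof.
rewrite laplacian_mul.
have predP : ord_pred i != ordS i.
  by apply/eqP => e; move/ordS_asym: e; rewrite ord_predK eqxx.
rewrite (bigD1 (ordS i)) //= (bigD1 (ord_pred i)) //= big1 => [|j].
  rewrite !mxE eqxx (negPf predP) ord_predK eqxx; ring.
case/andP=> jS jP; rewrite mxE (negPf jS).
by case: eqP => [e|]; [rewrite e ordSK eqxx in jP | rewrite mul0r].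
Qed.

(** The Laplacian is the divergence of the Ohmic current: it sends the
    potential of a flow that obeys Kirchhoff's voltage law to the net outflow
    at each vertex. *)
Lemma cycle_laplacian_flow f i :
    \sum_s r s * f s = 0 ->
  (L *m flow_potential c f) i 0 = f i - f (ord_pred i).
Proof.
move=> kvl; have cr s : c s * (r s * f s) = f s.
  by rewrite /edge_res; field; rewrite gt_eqF.
have := flow_potential_step (ord_pred i) kvl; rewrite ord_predK => step_pred.
by rewrite cycle_laplacian_mul flow_potential_step // step_pred !cr.
Qed.

Lemma cycle_laplacian_arc_flow (a b : 'I_n) :
  (a < b)%N -> L *m flow_potential c (arc_flow c a b) = ediff R a b.
Proof.
move=> ab; apply/colP => i; rewrite ediffE.
rewrite cycle_laplacian_flow ?arc_flow_kvl // /arc_flow.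
have /(congr1 (fun m => m%:R : R)) := arc_boundary i ab.
by rewrite !natrD; lra.
Qed.

Lemma cycle_laplacian_potential (a b : 'I_n) :
  exists x, L *m x = ediff R a b.
Proof.
case: (ltngtP a b) => [ab|ba|/val_inj ->].
- by exists (flow_potential c (arc_flow c a b)); exact: cycle_laplacian_arc_flow.
- exists (- flow_potential c (arc_flow c b a)).
  by rewrite mulmxN cycle_laplacian_arc_flow // opprB.
- by exists 0; rewrite mulmx0 /ediff subrr.
Qed.

Lemma effres_cycle (a b : 'I_n) :
  (a < b)%N -> effres L a b = d a b * (T - d a b) / T.
Proof.
move=> ab.
rewrite (effres_potential trmx_cycle_laplacian (cycle_laplacian_arc_flow ab)).
have T0 : T != 0 by rewrite gt_eqF ?total_res_gt0.
rewrite !mxE opprK addrC.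
have -> : \sum_(s < n | (s < b)%N) r s * arc_flow c a b s
        = \sum_(s < n | (s < a)%N) r s * arc_flow c a b s
          + \sum_(s < n | (a <= s < b)%N) r s * arc_flow c a b s.
  rewrite (bigID (fun s : 'I_n => (s < a)%N)) /=.
  by congr (_ + _); apply: eq_bigl => s; lia.
rewrite addrAC subrr add0r.
under eq_bigr do rewrite mulrBr.
rewrite sumrB sum_arc_indicator // -mulr_suml -arc_resE //.
by field.
Qed.

Lemma effres_chord (p q u v : 'I_n) w : 1 + w * effres L p q != 0 ->
  effres (chord_laplacian c p q w) u v
    = effres L u v - w / (4 * (1 + w * effres L p q))
        * (effres L u q + effres L v p - effres L u p - effres L v q) ^+ 2.
Proof.
move=> nz.
have [x Lx] := cycle_laplacian_potential u v.
have [y Ly] := cycle_laplacian_potential p q.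
rewrite (effres_polarization trmx_cycle_laplacian Lx Ly).
rewrite (effres_add_edge_potential trmx_cycle_laplacian Lx Ly nz).
by field.
Qed.

End Cycle.

Theorem lemma3p2 (R : realType) (n : nat) (c : 'I_n -> R) (p q : 'I_n) (w : R)
    (hn : (3 <= n)%N) (hc : forall i : 'I_n, 0 < c i)
    (hpq : (p < q)%N) (hw : 0 <= w) :
  let L := cycle_laplacian c in
  let Lw := chord_laplacian c p q w in
  let Rs := effres L in
  let Rw := effres Lw in
  let d := arc_res c in
  let T := total_res c in
  let A := d p q in
  let B := d q p in
  [/\ Rw p q = Rs p q / (1 + w * Rs p q)
      /\ Rs p q / (1 + w * Rs p q) = A * B / (T + w * A * B),
      forall u v : 'I_n,
        Rw u v = Rs u v - w / (4 * (1 + w * Rs p q))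
                          * (Rs u q + Rs v p - Rs u p - Rs v q) ^+ 2
    & kirchhoff L
        = 1 / T * (\sum_(u < n) \sum_(v < n | (u < v)%N) d u v * (T - d u v))
      /\ kirchhoff Lw = kirchhoff L - kirchhoff_drop c p q w].
Proof.
move=> L Lw Rs Rw d T A B.
have T_gt0 : 0 < T by exact: total_res_gt0.
have RsE : Rs p q = A * B / T by rewrite /Rs effres_cycle // /B /d (arc_res_flip _ hpq).
have AB_ge0 : 0 <= A * B by rewrite mulr_ge0 ?arc_res_ge0.
have nz : 1 + w * Rs p q != 0.
  by rewrite RsE gt_eqF // ltr_pwDl // mulr_ge0 // divr_ge0 // ltW.
have RwE u v : Rw u v = Rs u v - w / (4 * (1 + w * Rs p q))
                          * (Rs u q + Rs v p - Rs u p - Rs v q) ^+ 2.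
  exact: effres_chord.
split=> //; split.
- have Rs0 i : Rs i i = 0 by rewrite /Rs effresE; ring.
  have RsC : Rs q p = Rs p q by rewrite /Rs !effresE; ring.
  by rewrite RwE !Rs0 RsC; field.
- have nz' : T + w * A * B != 0.
    by rewrite -mulrA gt_eqF // ltr_pwDl // mulr_ge0.
  by rewrite RsE; field; rewrite nz' (gt_eqF T_gt0).
- rewrite /kirchhoff div1r mulr_sumr; apply: eq_bigr => u _.
  rewrite mulr_sumr; apply: eq_bigr => v uv.
  by rewrite effres_cycle // mulrC.
- rewrite /kirchhoff_drop mulrAC !mulr_sumr /kirchhoff -sumrB.
  apply: eq_bigr => u _; rewrite mulr_sumr -sumrB; apply: eq_bigr => v _.
  exact: RwE.
Qed.
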